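(* Consider $\alpha+\beta\to\infty$, and put $$C=\alpha,\qquad \gamma=\alpha+\beta,\qquad \xi=\tfrac12(\alpha+\beta+2)(1-x).$$ Then the Jacobi polynomials have the first term approximation $$P_n^{(\alpha,\beta)}(x)=L_n^{(C)}(\xi)+\mathcal{O}\left(\gamma^{n-1}\right),\qquad \gamma=\alpha+\beta\to\infty .$$
   Context: The Jacobi polynomials $P_n^{(\alpha,\beta)}(x)$, $n=0,1,2,\ldots$, are given by the generating function $$\frac{2^{\alpha+\beta}(1+R-w)^{-\alpha}(1+R+w)^{-\beta}}{R}=\sum_{n=0}^\infty P_n^{(\alpha,\beta)}(x)\,w^n,\qquad R=R(w)=\sqrt{1-2xw+w^2},$$ where $R=1$ at $w=0$. The Laguerre polynomials $L_n^{(\alpha)}(x)$ are defined, for $\alpha,x\in\mathbb{C}$, by the generating function $$(1-w)^{-\alpha-1}e^{-wx/(1-w)}=\sum_{n=0}^\infty L_n^{(\alpha)}(x)\,w^n,\qquad |w|<1.$$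
   Formalization: The estimate is stated under the added condition |α| ≤ K|α+β| (any fixed K), without which it fails (n = 2, x = 0, α = γ², β = γ − γ²), and uniformly for bounded x, |x| ≤ X; the constants depend on n, K and X. *)

(* Defs.v *)
(* Stdlib reals with Coquelicot's complex numbers. *)
From Stdlib Require Import Reals.
From Coquelicot Require Import Coquelicot.

Open Scope C_scope.

Definition Cexp (z : C) : C :=
  ((exp (Re z) * cos (Im z))%R, (exp (Re z) * sin (Im z))%R).

(* Principal argument, in ]-PI, PI] for z <> 0. *)
Definition Carg (z : C) : R :=
  if Rle_dec 0 (Im z) then acos (Re z / Cmod z) else (- acos (Re z / Cmod z))%R.

Definition Clog (z : C) : C := (ln (Cmod z), Carg z).

(* Principal value of z ^ a; meaningful for z <> 0 only. *)
Definition Cpower (z a : C) : C := Cexp (a * Clog z).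

Definition Csqrt (z : C) : C := RtoC (sqrt (Cmod z)) * Cexp (0, (Carg z / 2)%R).

(* Near w = 0 the principal square root is the continuous branch with R(0) = 1. *)
Definition Jacobi_R (x w : C) : C := Csqrt (1 - 2 * x * w + w ^ 2).

Definition Jacobi_genfun (alpha beta x w : C) : C :=
  let R := Jacobi_R x w in
  Cpower 2 (alpha + beta) * Cpower (1 + R - w) (- alpha)
    * Cpower (1 + R + w) (- beta) / R.

Definition Laguerre_genfun (alpha x w : C) : C :=
  Cpower (1 - w) (- alpha - 1) * Cexp (- (w * x) / (1 - w)).

(* [P n alpha beta x] is the Jacobi polynomial P_n^(alpha,beta)(x).  The
   identity is required on some disc around 0, which may depend on the
   parameters; this determines P uniquely. *)
Definition is_Jacobi (P : nat -> C -> C -> C -> C) : Prop :=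
  forall alpha beta x : C, exists r : posreal, forall w : C,
    (Cmod w < r)%R ->
    is_pseries (fun n => P n alpha beta x) w (Jacobi_genfun alpha beta x w).

(* [L n alpha x] is the Laguerre polynomial L_n^(alpha)(x). *)
Definition is_Laguerre (L : nat -> C -> C -> C) : Prop :=
  forall alpha x w : C,
    (Cmod w < 1)%R ->
    is_pseries (fun n => L n alpha x) w (Laguerre_genfun alpha x w).

(* Main.v *)
(** For real t near 0 both generating functions satisfy a linear differential
    equation: with Q = 1 - 2xt + t^2 = R^2 and gamma = alpha + beta,
      2t (Q F' - (x - t) F) = (gamma (R - Q) + (alpha - beta) t R) F
    for the Jacobi polynomials, and
      (1 - t)^2 G' = ((alpha + 1)(1 - t) - xi) G
    for the Laguerre polynomials.  The coefficients of R = Q (1 / R) are bounded,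
    since 1 / R is the generating function of the P_n^(0,0)(x).  Comparing
    coefficients, both sequences satisfy
      (m + 1) p_(m+1) = h p_m + O(gamma^m)
    with the same h = alpha + 1 - xi = O(gamma).  Hence both are O(gamma^n), and
    by induction on n their difference d_n satisfies gamma d_n = O(gamma^n). *)
Require Import Defs.
From Stdlib Require Import Reals ZArith Lra Lia.
From Coquelicot Require Import Coquelicot.

Open Scope C_scope.

(** * Principal powers and derivatives of complex-valued curves *)

Lemma C_eq (z w : C) : Re z = Re w -> Im z = Im w -> z = w.
Proof. destruct z, w; simpl; intros -> ->; reflexivity. Qed.

Lemma Re_pos_neq_0 (z : C) : (0 < Re z)%R -> z <> 0.
Proof. intros H E; rewrite E in H; simpl in H; lra. Qed.

Lemma Cmod_pos_of_Re (z : C) : (0 < Re z)%R -> (0 < Cmod z)%R.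
Proof. intros H; apply Cmod_gt_0, Re_pos_neq_0, H. Qed.

Lemma Cexp_plus (z w : C) : Cexp (z + w) = Cexp z * Cexp w.
Proof.
  destruct z as [a b], w as [c d]; unfold Cexp; apply C_eq; simpl;
    rewrite exp_plus; [rewrite cos_plus | rewrite sin_plus]; ring.
Qed.

Lemma Cexp_0 : Cexp 0 = 1.
Proof.
  unfold Cexp; simpl; rewrite exp_0, cos_0, sin_0.
  apply C_eq; simpl; ring.
Qed.

Lemma Cexp_opp (z : C) : Cexp z * Cexp (- z) = 1.
Proof. rewrite <- Cexp_plus; replace (z + - z) with (RtoC 0) by ring; apply Cexp_0. Qed.

(** The factor [sqrt (1 + y²)] is the denominator occurring in [cos_atan] and [sin_atan], so polar
    coordinates can be checked by [field]. *)
Lemma Cmod_Re_sqrt (z : C) : (0 < Re z)%R ->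
  Cmod z = (Re z * sqrt (1 + (Im z / Re z)²))%R.
Proof.
  destruct z as [a b]; simpl; intros Ha.
  transitivity (sqrt (a²) * sqrt (1 + (b / a)²))%R.
  - rewrite <- sqrt_mult_alt by apply Rle_0_sqr.
    unfold Cmod; simpl; f_equal; unfold Rsqr; field; lra.
  - rewrite sqrt_Rsqr by lra; reflexivity.
Qed.

(** In the right half-plane both branches of [Carg] merge into one smooth formula, because the
    argument stays strictly between -PI/2 and PI/2. *)
Lemma Carg_atan (z : C) : (0 < Re z)%R -> Carg z = atan (Im z / Re z).
Proof.
  destruct z as [a b]; simpl; intros Ha.
  assert (Hm : Cmod (a, b) = (a * sqrt (1 + (b / a)²))%R).
  { exact (Cmod_Re_sqrt (a, b) Ha). }
  assert (Hs : (0 < sqrt (1 + (b / a)²))%R).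
  { apply sqrt_lt_R0; pose proof (Rle_0_sqr (b / a)); lra. }
  assert (Hc : (Re (a, b) / Cmod (a, b))%R = cos (atan (b / a))).
  { rewrite cos_atan, Hm; simpl; field; lra. }
  pose proof (atan_bound (b / a)) as Hb.
  unfold Carg; rewrite Hc; simpl.
  destruct (Rle_dec 0 b) as [Hp | Hn].
  - assert (0 <= atan (b / a))%R.
    { rewrite <- atan_0.
      assert (0 <= b / a)%R by (apply Rdiv_le_0_compat; lra).
      destruct (Req_dec (b / a) 0) as [-> | Hne]; [lra |].
      left; apply atan_increasing; lra. }
    apply acos_cos; lra.
  - assert (atan (b / a) < 0)%R.
    { rewrite <- atan_0; apply atan_increasing.
      apply Ropp_lt_cancel; rewrite Ropp_0.
      replace (- (b / a))%R with (- b / a)%R by (field; lra).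
      apply Rdiv_lt_0_compat; lra. }
    (* Cosine is even, and the negated angle lies in [0, PI], where [acos] inverts it. *)
    rewrite <- cos_neg, acos_cos; lra.
Qed.

(** A form of the logarithm without square root or case distinction, suited to differentiation. *)
Lemma Clog_Re_pos (z : C) : (0 < Re z)%R ->
  Clog z = ((ln (Re z ^ 2 + Im z ^ 2) / 2)%R, atan (Im z / Re z)).
Proof.
  intros H; unfold Clog; rewrite (Carg_atan z H); f_equal.
  unfold Cmod; fold (Re z); fold (Im z).
  assert (0 < Re z ^ 2 + Im z ^ 2)%R by nra.
  assert (Hs : (0 < sqrt (Re z ^ 2 + Im z ^ 2))%R) by (apply sqrt_lt_R0; assumption).
  rewrite <- (sqrt_sqrt (Re z ^ 2 + Im z ^ 2)) at 2 by lra.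
  rewrite ln_mult by assumption; field.
Qed.

Lemma Cexp_Clog (z : C) : (0 < Re z)%R -> Cexp (Clog z) = z.
Proof.
  intros H; unfold Clog; rewrite (Carg_atan z H); unfold Cexp; simpl.
  pose proof (Cmod_pos_of_Re z H) as Hm.
  rewrite exp_ln by assumption.
  rewrite cos_atan, sin_atan.
  assert (Hs : (0 < sqrt (1 + (Im z / Re z)²))%R).
  { apply sqrt_lt_R0; pose proof (Rle_0_sqr (Im z / Re z)); lra. }
  rewrite (Cmod_Re_sqrt z H); apply C_eq; simpl; field; lra.
Qed.

Lemma Cexp_opp_Clog (z : C) : (0 < Re z)%R -> Cexp (- Clog z) = / z.
Proof.
  intros H; pose proof (Re_pos_neq_0 z H).
  rewrite <- (Cmult_1_l (/ z)), <- (Cexp_opp (Clog z)), (Cexp_Clog z H).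
  field; assumption.
Qed.

(** Reduces the square root to exponential and logarithm, from which both its square and its
    derivative follow. *)
Lemma Csqrt_Cexp (z : C) : (0 < Re z)%R -> Csqrt z = Cexp (/ 2 * Clog z).
Proof.
  intros H; pose proof (Cmod_pos_of_Re z H) as Hm.
  unfold Csqrt, Clog, Cexp.
  rewrite <- RtoC_inv by lra; simpl.
  replace (/ 2 * ln (Cmod z) - 0 * Carg z)%R with (ln (Cmod z) * / 2)%R by ring.
  replace (/ 2 * Carg z + 0 * ln (Cmod z))%R with (Carg z / 2)%R by field.
  rewrite exp_0.
  rewrite (Rmult_comm (ln _)); fold (Rpower (Cmod z) (/ 2)).
  rewrite (Rpower_sqrt _ Hm).
  apply C_eq; simpl; ring.
Qed.

Lemma Csqrt_sqr (z : C) : (0 < Re z)%R -> Csqrt z * Csqrt z = z.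
Proof.
  intros H; rewrite (Csqrt_Cexp z H), <- Cexp_plus.
  replace (/ 2 * Clog z + / 2 * Clog z) with (Clog z) by field.
  apply Cexp_Clog, H.
Qed.

(* [ring] does not see through the type of the equation, which is a
   Coquelicot structure whose carrier is R. *)
Ltac R_ring :=
  match goal with |- @eq _ ?a ?b => change (@eq R a b) end;
  unfold Re, Im; ring.

(** The derivative is taken along the real line only, componentwise, so that the calculus of real
    functions suffices. *)
Definition is_Cderive (f : R -> C) (t : R) (d : C) : Prop :=
  is_derive (fun u => Re (f u)) t (Re d) /\ is_derive (fun u => Im (f u)) t (Im d).

Lemma is_Cderive_eq (f : R -> C) (t : R) (d d' : C) :
  is_Cderive f t d -> d = d' -> is_Cderive f t d'.
Proof. intros H <-; exact H. Qed.

Lemma is_Cderive_ext_loc (f g : R -> C) (t : R) (d : C) :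
  locally t (fun u => f u = g u) -> is_Cderive f t d -> is_Cderive g t d.
Proof.
  intros H [H1 H2]; split.
  - apply (is_derive_ext_loc (fun u => Re (f u))); [| exact H1].
    apply filter_imp with (2 := H); intros u ->; reflexivity.
  - apply (is_derive_ext_loc (fun u => Im (f u))); [| exact H2].
    apply filter_imp with (2 := H); intros u ->; reflexivity.
Qed.

Lemma is_Cderive_const (c : C) (t : R) : is_Cderive (fun _ => c) t 0.
Proof. split; apply @is_derive_const. Qed.

Lemma is_Cderive_RtoC (t : R) : is_Cderive RtoC t 1.
Proof. split; simpl; [apply @is_derive_id | apply @is_derive_const]. Qed.

Lemma is_Cderive_plus (f g : R -> C) (t : R) (df dg : C) :
  is_Cderive f t df -> is_Cderive g t dg ->
  is_Cderive (fun u => f u + g u) t (df + dg).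
Proof. intros [f1 f2] [g1 g2]; split; simpl; apply @is_derive_plus; assumption. Qed.

Lemma is_Cderive_mult (f g : R -> C) (t : R) (df dg : C) :
  is_Cderive f t df -> is_Cderive g t dg ->
  is_Cderive (fun u => f u * g u) t (df * g t + f t * dg).
Proof.
  intros [f1 f2] [g1 g2].
  pose proof (is_derive_mult _ _ _ _ _ f1 g1 Rmult_comm) as H11.
  pose proof (is_derive_mult _ _ _ _ _ f2 g2 Rmult_comm) as H22.
  pose proof (is_derive_mult _ _ _ _ _ f1 g2 Rmult_comm) as H12.
  pose proof (is_derive_mult _ _ _ _ _ f2 g1 Rmult_comm) as H21.
  split.
  - evar_last; [exact (is_derive_minus _ _ _ _ _ H11 H22) |].
    unfold minus, plus, opp, mult; simpl; R_ring.
  - evar_last; [exact (is_derive_plus _ _ _ _ _ H12 H21) |].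
    unfold plus, mult; simpl; R_ring.
Qed.

Lemma is_Cderive_scal (c : C) (f : R -> C) (t : R) (df : C) :
  is_Cderive f t df -> is_Cderive (fun u => c * f u) t (c * df).
Proof.
  intros H; eapply is_Cderive_eq; [exact (is_Cderive_mult _ _ _ _ _ (is_Cderive_const c t) H) |].
  simpl; ring.
Qed.

Lemma is_Cderive_opp (f : R -> C) (t : R) (df : C) :
  is_Cderive f t df -> is_Cderive (fun u => - f u) t (- df).
Proof. intros [f1 f2]; split; simpl; apply @is_derive_opp; assumption. Qed.

Lemma is_Cderive_minus (f g : R -> C) (t : R) (df dg : C) :
  is_Cderive f t df -> is_Cderive g t dg ->
  is_Cderive (fun u => f u - g u) t (df - dg).
Proof. intros Hf Hg; apply is_Cderive_plus; [exact Hf | apply is_Cderive_opp, Hg]. Qed.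

Lemma is_Cderive_Cexp (f : R -> C) (t : R) (df : C) :
  is_Cderive f t df -> is_Cderive (fun u => Cexp (f u)) t (df * Cexp (f t)).
Proof.
  intros [f1 f2].
  pose proof (is_derive_comp exp _ _ _ _ (is_derive_exp _) f1) as He.
  pose proof (is_derive_comp cos _ _ _ _ (is_derive_cos _) f2) as Hc.
  pose proof (is_derive_comp sin _ _ _ _ (is_derive_sin _) f2) as Hs.
  split; simpl.
  - evar_last; [exact (is_derive_mult _ _ _ _ _ He Hc Rmult_comm) |].
    unfold plus, scal, mult; simpl; unfold mult; simpl; R_ring.
  - evar_last; [exact (is_derive_mult _ _ _ _ _ He Hs Rmult_comm) |].
    unfold plus, scal, mult; simpl; unfold mult; simpl; R_ring.
Qed.

(** By continuity a curve stays in the right half-plane for nearby parameters; formulas valid there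
    may then be substituted before differentiating. *)
Lemma is_Cderive_Re_pos (f : R -> C) (t : R) (df : C) :
  is_Cderive f t df -> (0 < Re (f t))%R -> locally t (fun u => 0 < Re (f u))%R.
Proof.
  intros [f1 _] H.
  assert (Hc : continuous (fun u => Re (f u)) t).
  { apply @ex_derive_continuous; eexists; exact f1. }
  apply (Hc (fun y => 0 < y)%R).
  apply (open_gt 0 _ H).
Qed.

Lemma is_Cderive_Clog (f : R -> C) (t : R) (df : C) :
  is_Cderive f t df -> (0 < Re (f t))%R ->
  is_Cderive (fun u => Clog (f u)) t (df / f t).
Proof.
  intros Hf H.
  apply (is_Cderive_ext_loc
    (fun u => ((ln (Re (f u) ^ 2 + Im (f u) ^ 2) / 2)%R, atan (Im (f u) / Re (f u))))).
  { apply filter_imp with (2 := is_Cderive_Re_pos f t df Hf H).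
    intros u Hu; symmetry; apply Clog_Re_pos, Hu. }
  destruct Hf as [f1 f2].
  set (a := fun u => Re (f u)) in *; set (b := fun u => Im (f u)) in *.
  assert (Ha : (0 < a t)%R) by exact H.
  assert (Hn : (0 < a t ^ 2 + b t ^ 2)%R) by nra.
  split.
  - change (is_derive (fun u => (ln (a u ^ 2 + b u ^ 2) / 2)%R) t (Re (df / f t))).
    auto_derive.
    + repeat split; [eexists; exact f1 | eexists; exact f2 | simpl in *; lra].
    + change (fun x => a x) with a; change (fun x => b x) with b.
      rewrite (is_derive_unique a t _ f1), (is_derive_unique b t _ f2).
      unfold a, b, Re, Im in *; simpl; field; simpl in Hn; lra.
  - change (is_derive (fun u => atan (b u / a u)) t (Im (df / f t))).
    auto_derive.
    + repeat split; [eexists; exact f2 | eexists; exact f1 | lra].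
    + change (fun x => a x) with a; change (fun x => b x) with b.
      rewrite (is_derive_unique a t _ f1), (is_derive_unique b t _ f2).
      unfold a, b, Re, Im in *; simpl; field; simpl in Hn; repeat split; lra.
Qed.

(** In the right half-plane 1/z = exp(-log z), so the rules for [Cexp] and [Clog] apply. *)
Lemma is_Cderive_inv (f : R -> C) (t : R) (df : C) :
  is_Cderive f t df -> (0 < Re (f t))%R ->
  is_Cderive (fun u => / f u) t (- df / (f t * f t)).
Proof.
  intros Hf H.
  apply (is_Cderive_ext_loc (fun u => Cexp (- Clog (f u)))).
  { apply filter_imp with (2 := is_Cderive_Re_pos f t df Hf H).
    intros u Hu; apply Cexp_opp_Clog, Hu. }
  eapply is_Cderive_eq.
  - apply is_Cderive_Cexp, is_Cderive_opp, (is_Cderive_Clog _ _ _ Hf H).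
  - simpl; rewrite (Cexp_opp_Clog _ H); field; apply Re_pos_neq_0, H.
Qed.

Lemma is_Cderive_Csqrt (f : R -> C) (t : R) (df : C) :
  is_Cderive f t df -> (0 < Re (f t))%R ->
  is_Cderive (fun u => Csqrt (f u)) t (df / (2 * f t) * Csqrt (f t)).
Proof.
  intros Hf H.
  apply (is_Cderive_ext_loc (fun u => Cexp (/ 2 * Clog (f u)))).
  { apply filter_imp with (2 := is_Cderive_Re_pos f t df Hf H).
    intros u Hu; symmetry; apply Csqrt_Cexp, Hu. }
  rewrite (Csqrt_Cexp _ H).
  eapply is_Cderive_eq.
  - apply is_Cderive_Cexp, is_Cderive_scal, (is_Cderive_Clog _ _ _ Hf H).
  - simpl; field; apply Re_pos_neq_0, H.
Qed.

Lemma is_Cderive_Cpower (f : R -> C) (a : C) (t : R) (df : C) :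
  is_Cderive f t df -> (0 < Re (f t))%R ->
  is_Cderive (fun u => Cpower (f u) a) t (a * df / f t * Cpower (f t) a).
Proof.
  intros Hf H; unfold Cpower.
  eapply is_Cderive_eq.
  - apply is_Cderive_Cexp, is_Cderive_scal, (is_Cderive_Clog _ _ _ Hf H).
  - simpl; field; apply Re_pos_neq_0, H.
Qed.

(** * Power series expansions at 0 along the real line *)

Definition real_expansion (a : nat -> R) (f : R -> R) : Prop :=
  locally 0%R (fun t => is_pseries a t (f t)).

Lemma real_expansion_CV_radius (a : nat -> R) (f : R -> R) :
  real_expansion a f -> Rbar_lt 0 (CV_radius a).
Proof.
  intros [e He].
  assert (Hr : is_pseries a (e / 2)%R (f (e / 2)%R)).
  { apply He; change (Rabs (e / 2 - 0) < e)%R.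
    pose proof (cond_pos e); rewrite Rabs_pos_eq; lra. }
  apply Rbar_lt_le_trans with (Finite (e / 2)).
  { simpl; pose proof (cond_pos e); lra. }
  (* The series converges at e/2, so its terms tend to 0 there; beyond the radius of convergence
     they could not. *)
  apply Rbar_not_lt_le; intros Hlt.
  apply (CV_disk_outside a (e / 2)).
  - rewrite Rabs_pos_eq by (pose proof (cond_pos e); lra); exact Hlt.
  - apply ex_series_lim_0; eexists; apply is_pseries_R; exact Hr.
Qed.

Lemma CV_radius_locally (a : nat -> R) :
  Rbar_lt 0 (CV_radius a) -> locally 0%R (fun t => Rbar_lt (Rabs t) (CV_radius a)).
Proof.
  destruct (CV_radius a) as [r | |]; simpl; intros H; try easy.
  - exists (mkposreal r H); intros t Ht.
    change (Rabs (t - 0) < r)%R in Ht; rewrite Rminus_0_r in Ht; exact Ht.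
  - exists (mkposreal 1 Rlt_0_1); easy.
Qed.

Lemma real_expansion_plus (a b : nat -> R) (f g : R -> R) :
  real_expansion a f -> real_expansion b g ->
  real_expansion (fun n => a n + b n)%R (fun t => f t + g t)%R.
Proof.
  intros Ha Hb; apply (filter_imp _ _ (fun t H => is_pseries_plus a b t _ _ (proj1 H) (proj2 H))).
  apply filter_and; assumption.
Qed.

Lemma real_expansion_minus (a b : nat -> R) (f g : R -> R) :
  real_expansion a f -> real_expansion b g ->
  real_expansion (fun n => a n - b n)%R (fun t => f t - g t)%R.
Proof.
  intros Ha Hb; apply (filter_imp _ _ (fun t H => is_pseries_minus a b t _ _ (proj1 H) (proj2 H))).
  apply filter_and; assumption.
Qed.

Lemma real_expansion_mult (a b : nat -> R) (f g : R -> R) :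
  real_expansion a f -> real_expansion b g ->
  real_expansion (PS_mult a b) (fun t => f t * g t)%R.
Proof.
  intros Ha Hb.
  (* The Cauchy product formula is available strictly inside both discs of convergence. *)
  pose proof (CV_radius_locally a (real_expansion_CV_radius a f Ha)) as Ra.
  pose proof (CV_radius_locally b (real_expansion_CV_radius b g Hb)) as Rb.
  apply (filter_imp _ _ (fun t H => is_pseries_mult a b t _ _
    (proj1 (proj1 H)) (proj2 (proj1 H)) (proj1 (proj2 H)) (proj2 (proj2 H)))).
  apply filter_and; apply filter_and; assumption.
Qed.

Lemma real_expansion_derive (a : nat -> R) (f df : R -> R) :
  real_expansion a f -> locally 0%R (fun t => is_derive f t (df t)) ->
  real_expansion (PS_derive a) df.
Proof.
  intros Ha Hd.
  pose proof (CV_radius_locally a (real_expansion_CV_radius a f Ha)) as Ra.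
  (* To identify the derivative at t, f must agree with the sum of its series on a whole
     neighbourhood of t. *)
  apply (locally_locally (0%R : R_UniformSpace)) in Ha.
  unfold real_expansion; generalize (filter_and _ _ Ha (filter_and _ _ Hd Ra)).
  apply filter_imp; intros t (H1 & H2 & H3).
  replace (df t) with (Derive (PSeries a) t); [apply is_pseries_derive, H3 |].
  apply is_derive_unique, (is_derive_ext_loc f); [| exact H2].
  apply filter_imp with (2 := H1); intros u Hu; symmetry; apply is_pseries_unique, Hu.
Qed.

Lemma real_expansion_unique (a b : nat -> R) (f g : R -> R) (n : nat) :
  real_expansion a f -> real_expansion b g -> locally 0%R (fun t => f t = g t) ->
  a n = b n.
Proof.
  intros Ha Hb E.
  apply PSeries_ext_recip;
    [exact (real_expansion_CV_radius a f Ha) | exact (real_expansion_CV_radius b g Hb) |].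
  generalize (filter_and _ _ E (filter_and _ _ Ha Hb)).
  apply filter_imp; intros t (H1 & H2 & H3).
  rewrite (is_pseries_unique _ _ _ H2), (is_pseries_unique _ _ _ H3); exact H1.
Qed.

Lemma real_expansion_ext (a b : nat -> R) (f : R -> R) :
  (forall n, a n = b n) -> real_expansion a f -> real_expansion b f.
Proof. intros E; unfold real_expansion; apply filter_imp; intros t; apply is_pseries_ext, E. Qed.

(* Only real values of the expansion variable are needed, and then the real and
   imaginary parts of a complex power series are real power series. *)
Definition expansion (a : nat -> C) (f : R -> C) : Prop :=
  real_expansion (fun n => Re (a n)) (fun t => Re (f t)) /\
  real_expansion (fun n => Im (a n)) (fun t => Im (f t)).

(** Coefficients of t f(t); the default 0 plays the part of the coefficient with index -1. *)
Definition shift_seq (a : nat -> C) (n : nat) : C :=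
  match n with O => 0 | S m => a m end.

Definition derive_seq (a : nat -> C) (n : nat) : C := INR (S n) * a (S n).

Definition Cauchy_prod (a b : nat -> C) (n : nat) : C :=
  sum_n_m (fun k => a k * b (n - k)%nat) 0 n.

Lemma Re_sum_n (a : nat -> C) (n : nat) : Re (sum_n a n) = sum_n (fun k => Re (a k)) n.
Proof.
  induction n as [|n IH]; [rewrite !sum_O | rewrite !sum_Sn, <- IH]; reflexivity.
Qed.

Lemma Im_sum_n (a : nat -> C) (n : nat) : Im (sum_n a n) = sum_n (fun k => Im (a k)) n.
Proof.
  induction n as [|n IH]; [rewrite !sum_O | rewrite !sum_Sn, <- IH]; reflexivity.
Qed.

Lemma pow_n_RtoC (t : R) (n : nat) : pow_n (RtoC t) n = RtoC (pow_n t n).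
Proof.
  induction n as [|n IH]; simpl; [reflexivity |].
  rewrite IH; symmetry; apply RtoC_mult.
Qed.

Lemma filterlim_Re (z : C) :
  filterlim Re (@locally C_UniformSpace z) (@locally R_UniformSpace (Re z)).
Proof. destruct z as [x y]; apply (@continuous_fst R_UniformSpace R_UniformSpace x y). Qed.

Lemma filterlim_Im (z : C) :
  filterlim Im (@locally C_UniformSpace z) (@locally R_UniformSpace (Im z)).
Proof. destruct z as [x y]; apply (@continuous_snd R_UniformSpace R_UniformSpace x y). Qed.

(** [Re] and [Im] are continuous and commute with partial sums, since the powers of a real t are
    real. *)
Lemma is_pseries_expansion (a : nat -> C) (F : C -> C) (r : posreal) :
  (forall w, (Cmod w < r)%R -> is_pseries a w (F w)) ->
  expansion a (fun t => F (RtoC t)).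
Proof.
  intros H.
  split; exists r; intros t Ht; change (Rabs (t - 0) < r)%R in Ht;
    rewrite Rminus_0_r, <- Cmod_R in Ht; specialize (H _ Ht).
  - eapply filterlim_ext; [| apply (filterlim_comp _ _ _ _ _ _ _ _ H (filterlim_Re (F t)))].
    intros n; etransitivity; [exact (Re_sum_n (fun k => scal (pow_n (RtoC t) k) (a k)) n) |].
    apply sum_n_ext; intros k; rewrite pow_n_RtoC.
    change (Re (RtoC (pow_n t k) * a k) = (pow_n t k * Re (a k))%R); simpl; unfold Re; ring.
  - eapply filterlim_ext; [| apply (filterlim_comp _ _ _ _ _ _ _ _ H (filterlim_Im (F t)))].
    intros n; etransitivity; [exact (Im_sum_n (fun k => scal (pow_n (RtoC t) k) (a k)) n) |].
    apply sum_n_ext; intros k; rewrite pow_n_RtoC.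
    change (Im (RtoC (pow_n t k) * a k) = (pow_n t k * Im (a k))%R); simpl; unfold Im; ring.
Qed.

Lemma expansion_plus (a b : nat -> C) (f g : R -> C) :
  expansion a f -> expansion b g ->
  expansion (fun n => a n + b n) (fun t => f t + g t).
Proof. intros [a1 a2] [b1 b2]; split; apply real_expansion_plus; assumption. Qed.

Lemma expansion_minus (a b : nat -> C) (f g : R -> C) :
  expansion a f -> expansion b g ->
  expansion (fun n => a n - b n) (fun t => f t - g t).
Proof. intros [a1 a2] [b1 b2]; split; apply real_expansion_minus; assumption. Qed.

Lemma expansion_mult (a b : nat -> C) (f g : R -> C) :
  expansion a f -> expansion b g ->
  expansion (Cauchy_prod a b) (fun t => f t * g t).
Proof.
  intros [a1 a2] [b1 b2]; split.
  - eapply real_expansion_ext;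
      [| exact (real_expansion_minus _ _ _ _ (real_expansion_mult _ _ _ _ a1 b1)
                  (real_expansion_mult _ _ _ _ a2 b2))].
    intros n; unfold Cauchy_prod, PS_mult; rewrite <- !sum_n_Reals.
    fold (sum_n (fun k => a k * b (n - k)%nat) n); rewrite Re_sum_n.
    (* Only the upper summation bounds are generalized; the n in the index n - k stays fixed, which
       makes induction on the bound possible. *)
    symmetry; generalize n at 2 4 6; intros m; induction m as [|m IH];
      [rewrite !sum_O | rewrite !sum_Sn, IH]; unfold plus; simpl; unfold Re, Im; ring.
  - eapply real_expansion_ext;
      [| exact (real_expansion_plus _ _ _ _ (real_expansion_mult _ _ _ _ a1 b2)
                  (real_expansion_mult _ _ _ _ a2 b1))].
    intros n; unfold Cauchy_prod, PS_mult; rewrite <- !sum_n_Reals.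
    fold (sum_n (fun k => a k * b (n - k)%nat) n); rewrite Im_sum_n.
    symmetry; generalize n at 2 4 6; intros m; induction m as [|m IH];
      [rewrite !sum_O | rewrite !sum_Sn, IH]; unfold plus; simpl; unfold Re, Im; ring.
Qed.

Lemma real_expansion_scal (c : R) (a : nat -> R) (f : R -> R) :
  real_expansion a f -> real_expansion (fun n => c * a n)%R (fun t => c * f t)%R.
Proof.
  unfold real_expansion; apply filter_imp; intros t Ht; apply (is_pseries_scal c a t (f t)); [apply Rmult_comm | exact Ht].
Qed.

Lemma expansion_scal (c : C) (a : nat -> C) (f : R -> C) :
  expansion a f -> expansion (fun n => c * a n) (fun t => c * f t).
Proof.
  intros [a1 a2]; split.
  - apply (real_expansion_minus _ _ _ _ (real_expansion_scal (Re c) _ _ a1)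
             (real_expansion_scal (Im c) _ _ a2)).
  - apply (real_expansion_plus _ _ _ _ (real_expansion_scal (Re c) _ _ a2)
             (real_expansion_scal (Im c) _ _ a1)).
Qed.

Lemma expansion_shift_seq (a : nat -> C) (f : R -> C) :
  expansion a f -> expansion (shift_seq a) (fun t => RtoC t * f t).
Proof.
  intros [a1 a2]; split.
  - generalize a1; unfold real_expansion; apply filter_imp; intros t Ht.
    replace (Re (RtoC t * f t)) with (scal t (Re (f t)))
      by (unfold scal; simpl; unfold mult; simpl; unfold Re; ring).
    apply is_pseries_ext with (2 := is_pseries_incr_1 _ _ _ Ht); intros [|n]; reflexivity.
  - generalize a2; unfold real_expansion; apply filter_imp; intros t Ht.
    replace (Im (RtoC t * f t)) with (scal t (Im (f t)))
      by (unfold scal; simpl; unfold mult; simpl; unfold Im; ring).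
    apply is_pseries_ext with (2 := is_pseries_incr_1 _ _ _ Ht); intros [|n]; reflexivity.
Qed.

Lemma expansion_derive (a : nat -> C) (f df : R -> C) :
  expansion a f -> locally 0%R (fun t => is_Cderive f t (df t)) ->
  expansion (derive_seq a) df.
Proof.
  intros [a1 a2] H; split.
  - eapply real_expansion_ext; [| apply (real_expansion_derive _ _ (fun t => Re (df t)) a1)].
    + intros n; unfold derive_seq, PS_derive; rewrite re_scal_l; reflexivity.
    + generalize H; apply filter_imp; intros t Ht; apply Ht.
  - eapply real_expansion_ext; [| apply (real_expansion_derive _ _ (fun t => Im (df t)) a2)].
    + intros n; unfold derive_seq, PS_derive; rewrite im_scal_l; reflexivity.
    + generalize H; apply filter_imp; intros t Ht; apply Ht.
Qed.

Lemma expansion_unique (a b : nat -> C) (f g : R -> C) (n : nat) :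
  expansion a f -> expansion b g -> locally 0%R (fun t => f t = g t) -> a n = b n.
Proof.
  intros [a1 a2] [b1 b2] E; apply C_eq.
  - apply (real_expansion_unique _ _ _ _ n a1 b1).
    generalize E; apply filter_imp; intros t ->; reflexivity.
  - apply (real_expansion_unique _ _ _ _ n a2 b2).
    generalize E; apply filter_imp; intros t ->; reflexivity.
Qed.

Lemma expansion_at_0 (a : nat -> C) (f : R -> C) : expansion a f -> a O = f 0%R.
Proof.
  assert (H : forall (u : nat -> R) (g : R -> R), real_expansion u g -> u O = g 0%R).
  { intros u g Hu; apply locally_singleton in Hu.
    apply is_pseries_unique in Hu; rewrite PSeries_0 in Hu; exact Hu. }
  intros [a1 a2]; apply C_eq; [exact (H _ _ a1) | exact (H _ _ a2)].
Qed.

(** * The Jacobi generating function *)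

Lemma Clog_1 : Clog 1 = 0.
Proof.
  rewrite Clog_Re_pos by (simpl; lra); simpl.
  replace (0 / 1)%R with 0%R by field; rewrite atan_0.
  replace (1 * (1 * 1) + 0 * (0 * 1))%R with 1%R by ring; rewrite ln_1.
  apply C_eq; simpl; field.
Qed.

Lemma Cpower_1_l (a : C) : Cpower 1 a = 1.
Proof. unfold Cpower; rewrite Clog_1, Cmult_0_r; apply Cexp_0. Qed.

Lemma Cpower_0_r (z : C) : Cpower z 0 = 1.
Proof. unfold Cpower; rewrite Cmult_0_l; apply Cexp_0. Qed.

Lemma Cpower_plus (z a b : C) : Cpower z (a + b) = Cpower z a * Cpower z b.
Proof. unfold Cpower; rewrite <- Cexp_plus; f_equal; ring. Qed.

Lemma Csqrt_1 : Csqrt 1 = 1.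
Proof.
  rewrite Csqrt_Cexp by (simpl; lra).
  rewrite Clog_1, Cmult_0_r; apply Cexp_0.
Qed.

Lemma Jacobi_R_0 (x : C) : Jacobi_R x 0 = 1.
Proof.
  unfold Jacobi_R; replace (1 - 2 * x * 0 + 0 ^ 2) with (RtoC 1) by ring; apply Csqrt_1.
Qed.

Lemma Jacobi_genfun_0 (alpha beta x : C) : Jacobi_genfun alpha beta x 0 = 1.
Proof.
  unfold Jacobi_genfun; rewrite Jacobi_R_0.
  replace (1 + 1 - 0) with (RtoC 2) by (apply C_eq; simpl; ring).
  replace (1 + 1 + 0) with (RtoC 2) by (apply C_eq; simpl; ring).
  rewrite <- !Cpower_plus.
  replace (alpha + beta + - alpha + - beta) with (RtoC 0) by ring.
  rewrite Cpower_0_r; field.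
Qed.

(* Near [t = 0] every base of a principal power lies in the right half-plane. *)
Definition regular_point (x : C) (t : R) : Prop :=
  let r := Jacobi_R x t in
  (0 < Re (1 - 2 * x * t + RtoC t ^ 2))%R /\ (0 < Re r)%R /\
  (0 < Re (1 + r - t))%R /\ (0 < Re (1 + r + t))%R.

Lemma is_Cderive_radicand (x : C) (t : R) :
  is_Cderive (fun u => 1 - 2 * x * RtoC u + RtoC u ^ 2) t (2 * (t - x)).
Proof.
  apply (is_Cderive_ext_loc (fun u => 1 - 2 * x * RtoC u + RtoC u * RtoC u)).
  { apply filter_forall; intros u; ring. }
  eapply is_Cderive_eq.
  - apply is_Cderive_plus.
    + apply is_Cderive_minus; [apply is_Cderive_const |].
      apply is_Cderive_scal, is_Cderive_RtoC.
    + apply is_Cderive_mult; apply is_Cderive_RtoC.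
  - simpl; ring.
Qed.

Lemma Jacobi_R_sqr (x : C) (t : R) : (0 < Re (1 - 2 * x * t + RtoC t ^ 2))%R ->
  Jacobi_R x t * Jacobi_R x t = 1 - 2 * x * t + RtoC t ^ 2.
Proof. intros H; apply Csqrt_sqr, H. Qed.

Lemma is_Cderive_Jacobi_R (x : C) (t : R) : (0 < Re (1 - 2 * x * t + RtoC t ^ 2))%R ->
  is_Cderive (fun u => Jacobi_R x u) t ((t - x) / Jacobi_R x t).
Proof.
  intros H.
  assert (HR := Jacobi_R_sqr x t H).
  assert (Hne : Jacobi_R x t <> 0).
  { intros E; apply (Re_pos_neq_0 _ H); rewrite <- HR, E; ring. }
  eapply is_Cderive_eq.
  - apply (is_Cderive_Csqrt _ _ _ (is_Cderive_radicand x t) H).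
  - cbv beta; fold (Jacobi_R x t); rewrite <- HR; field; exact Hne.
Qed.

Lemma regular_point_locally (x : C) : locally 0%R (regular_point x).
Proof.
  assert (HQ : (0 < Re (1 - 2 * x * RtoC 0 + RtoC 0 ^ 2))%R).
  { replace (1 - 2 * x * RtoC 0 + RtoC 0 ^ 2) with (RtoC 1) by ring; simpl; lra. }
  pose proof (is_Cderive_Jacobi_R x 0 HQ) as HR.
  assert (Hone : is_Cderive (fun u => 1 + Jacobi_R x u) 0 (0 + (0%R - x) / Jacobi_R x 0%R))
    by (apply is_Cderive_plus; [apply is_Cderive_const | exact HR]).
  (* At t = 0 the four quantities are 1, 1, 2 and 2, and positivity of the real part persists
     nearby. *)
  repeat apply filter_and.
  - exact (is_Cderive_Re_pos _ _ _ (is_Cderive_radicand x 0) HQ).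
  - apply (is_Cderive_Re_pos _ _ _ HR); rewrite Jacobi_R_0; simpl; lra.
  - apply (is_Cderive_Re_pos _ _ _ (is_Cderive_minus _ _ _ _ _ Hone (is_Cderive_RtoC 0))).
    rewrite Jacobi_R_0; simpl; lra.
  - apply (is_Cderive_Re_pos _ _ _ (is_Cderive_plus _ _ _ _ _ Hone (is_Cderive_RtoC 0))).
    rewrite Jacobi_R_0; simpl; lra.
Qed.

(** The generating function times its logarithmic derivative, where [dr] is the derivative of R. *)
Definition Jacobi_genfun_deriv (alpha beta x : C) (t : R) : C :=
  let r := Jacobi_R x t in
  let dr := (t - x) / r in
  Jacobi_genfun alpha beta x t *
    (- alpha * ((dr - 1) / (1 + r - t)) - beta * ((dr + 1) / (1 + r + t)) - dr / r).

Lemma is_Cderive_Jacobi_genfun (alpha beta x : C) (t : R) : regular_point x t ->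
  is_Cderive (fun u => Jacobi_genfun alpha beta x u) t (Jacobi_genfun_deriv alpha beta x t).
Proof.
  intros (HQ & HR & Hm & Hp).
  pose proof (is_Cderive_Jacobi_R x t HQ) as DR.
  pose proof (is_Cderive_plus _ _ _ _ _ (is_Cderive_const 1 t) DR) as D1.
  pose proof (is_Cderive_minus _ _ _ _ _ D1 (is_Cderive_RtoC t)) as Dm.
  pose proof (is_Cderive_plus _ _ _ _ _ D1 (is_Cderive_RtoC t)) as Dp.
  eapply is_Cderive_eq.
  - unfold Jacobi_genfun, Cdiv; apply is_Cderive_mult.
    + apply is_Cderive_mult.
      * apply is_Cderive_scal, (is_Cderive_Cpower _ (- alpha) _ _ Dm Hm).
      * apply (is_Cderive_Cpower _ (- beta) _ _ Dp Hp).
    + apply (is_Cderive_inv _ _ _ DR HR).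
  - unfold Jacobi_genfun_deriv, Jacobi_genfun; simpl.
    pose proof (Re_pos_neq_0 _ HR); pose proof (Re_pos_neq_0 _ Hm); pose proof (Re_pos_neq_0 _ Hp).
    field; repeat split; assumption.
Qed.

(** The factor 2t R^2 clears the denominators of the logarithmic derivative, because 1 - (R - t)^2 =
    2t (x - t + R) and 1 - (R + t)^2 = 2t (x - t - R). *)
Lemma Jacobi_genfun_ode (alpha beta x : C) (t : R) : regular_point x t ->
  let r := Jacobi_R x t in
  let F := Jacobi_genfun alpha beta x t in
  2 * (t * (r * r * Jacobi_genfun_deriv alpha beta x t - (x - t) * F)) =
  (alpha + beta) * (r * F) - (alpha + beta) * (r * r * F) + (alpha - beta) * (t * (r * F)).
Proof.
  intros (HQ & HR & Hm & Hp); unfold Jacobi_genfun_deriv.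
  pose proof (Jacobi_R_sqr x t HQ) as Hsq.
  apply Re_pos_neq_0 in HR; apply Re_pos_neq_0 in Hm; apply Re_pos_neq_0 in Hp.
  clear HQ; revert Hsq HR Hm Hp.
  generalize (Jacobi_genfun alpha beta x t), (Jacobi_R x t); intros F r Hsq HR Hm Hp; simpl.
  (* What remains is algebra in w, x and r subject to the single relation r^2 = 1 - 2xw + w^2. *)
  generalize dependent (RtoC t); intros w Hsq Hm Hp.
  assert (Em : 2 * w * (w - x - r) = - (1 + w - r) * (1 + r - w)).
  { transitivity (- (1 + w - r) * (1 + r - w) + ((1 - 2 * x * w + w ^ 2) - r * r)); [ring |].
    rewrite Hsq; ring. }
  assert (Ep : 2 * w * (w - x + r) = - (1 - w - r) * (1 + r + w)).
  { transitivity (- (1 - w - r) * (1 + r + w) + ((1 - 2 * x * w + w ^ 2) - r * r)); [ring |].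
    rewrite Hsq; ring. }
  assert (Dm : 2 * w * (r * r) * (((w - x) / r - 1) / (1 + r - w)) = - r * (1 + w - r)).
  { transitivity (r * (2 * w * (w - x - r)) / (1 + r - w)); [field; auto |].
    rewrite Em; field; auto. }
  assert (Dp : 2 * w * (r * r) * (((w - x) / r + 1) / (1 + r + w)) = - r * (1 - w - r)).
  { transitivity (r * (2 * w * (w - x + r)) / (1 + r + w)); [field; auto |].
    rewrite Ep; field; auto. }
  transitivity (F * (- alpha * (2 * w * (r * r) * (((w - x) / r - 1) / (1 + r - w)))
                     - beta * (2 * w * (r * r) * (((w - x) / r + 1) / (1 + r + w))))).
  - field; auto.
  - rewrite Dm, Dp; ring.
Qed.

Lemma shift_seq_derive_seq (p : nat -> C) (m : nat) : shift_seq (derive_seq p) m = INR m * p m.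
Proof. destruct m; [simpl; ring | reflexivity]. Qed.

(** Coefficients of t^2 F'. At index 0 the factor -1 is harmless, since it multiplies the default
    0. *)
Lemma shift_seq2_derive_seq (p : nat -> C) (m : nat) :
  shift_seq (shift_seq (derive_seq p)) m = (INR m - 1) * shift_seq p m.
Proof.
  destruct m as [|m]; [simpl; ring |].
  change (shift_seq (derive_seq p) m = (INR (S m) - 1) * p m).
  rewrite shift_seq_derive_seq, S_INR, RtoC_plus; ring.
Qed.

(* Coefficients of R, as (1 - 2xw + w^2) (1 / R). *)
Definition Jacobi_R_coef (P : nat -> C -> C -> C -> C) (x : C) (n : nat) : C :=
  let l := fun k => P k 0 0 x in l n - 2 * x * shift_seq l n + shift_seq (shift_seq l) n.

Lemma Jacobi_expansion (P : nat -> C -> C -> C -> C) (hP : is_Jacobi P) (alpha beta x : C) :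
  expansion (fun n => P n alpha beta x) (fun t => Jacobi_genfun alpha beta x t).
Proof.
  destruct (hP alpha beta x) as [r Hr].
  exact (is_pseries_expansion _ (Jacobi_genfun alpha beta x) r Hr).
Qed.

Lemma Jacobi_0 (P : nat -> C -> C -> C -> C) (hP : is_Jacobi P) (alpha beta x : C) : P 0%nat alpha beta x = 1.
Proof.
  rewrite <- (Jacobi_genfun_0 alpha beta x).
  exact (expansion_at_0 _ _ (Jacobi_expansion P hP alpha beta x)).
Qed.

Lemma expansion_mul_radicand (x : C) (a : nat -> C) (f : R -> C) : expansion a f ->
  expansion (fun n => a n - 2 * x * shift_seq a n + shift_seq (shift_seq a) n)
    (fun t => f t - 2 * x * (t * f t) + t * (t * f t)).
Proof.
  intros H; apply expansion_plus; [apply expansion_minus; [exact H |] |].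
  - apply expansion_scal, expansion_shift_seq, H.
  - apply expansion_shift_seq, expansion_shift_seq, H.
Qed.

Lemma expansion_ext_loc (a : nat -> C) (f g : R -> C) :
  locally 0%R (fun t => f t = g t) -> expansion a f -> expansion a g.
Proof.
  intros E [a1 a2]; split.
  - generalize (filter_and _ _ E a1); unfold real_expansion; apply filter_imp.
    intros t [<- Ht]; exact Ht.
  - generalize (filter_and _ _ E a2); unfold real_expansion; apply filter_imp.
    intros t [<- Ht]; exact Ht.
Qed.

(** For alpha = beta = 0 the generating function is 1/R, and multiplying it by the radicand R^2
    gives R. *)
Lemma Jacobi_R_expansion (P : nat -> C -> C -> C -> C) (hP : is_Jacobi P) (x : C) : expansion (Jacobi_R_coef P x) (fun t => Jacobi_R x t).
Proof.
  eapply expansion_ext_loc; [| apply expansion_mul_radicand, (Jacobi_expansion P hP 0 0 x)].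
  apply filter_imp with (2 := regular_point_locally x).
  intros t (HQ & HR & _); simpl.
  assert (E : Jacobi_genfun 0 0 x t = / Jacobi_R x t).
  { unfold Jacobi_genfun; simpl.
    replace (0 + 0) with (RtoC 0) by ring; replace (- 0) with (RtoC 0) by ring.
    rewrite !Cpower_0_r; field; apply Re_pos_neq_0, HR. }
  rewrite E.
  transitivity ((1 - 2 * x * t + RtoC t ^ 2) * / Jacobi_R x t); [ring |].
  rewrite <- (Jacobi_R_sqr x t HQ); field; apply Re_pos_neq_0, HR.
Qed.

(** Compares coefficients in the differential equation. With R^2 replaced by the radicand, only R F
    needs a genuine Cauchy product. *)
Lemma Jacobi_recurrence_Cauchy (P : nat -> C -> C -> C -> C) (hP : is_Jacobi P) (alpha beta x : C) (m : nat) :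
  let p := fun n => P n alpha beta x in
  let q := Jacobi_R_coef P x in
  2 * (INR (S m) * p (S m)) =
  2 * x * (2 * INR m + 1) * p m - 2 * INR m * shift_seq p m
  + (alpha + beta) * Cauchy_prod q p (S m)
  - (alpha + beta) * (p (S m) - 2 * x * p m + shift_seq p m)
  + (alpha - beta) * Cauchy_prod q p m.
Proof.
  intros p q.
  pose proof (Jacobi_expansion P hP alpha beta x) as Ep; fold p in Ep.
  pose proof (Jacobi_R_expansion P hP x) as Eq; fold q in Eq.
  assert (Ed : expansion (derive_seq p) (Jacobi_genfun_deriv alpha beta x)).
  { apply (expansion_derive _ _ _ Ep).
    apply filter_imp with (2 := regular_point_locally x).
    intros t; apply is_Cderive_Jacobi_genfun. }
  pose proof (expansion_mult _ _ _ _ Eq Ep) as Eqp.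
  pose proof (expansion_scal 2 _ _ (expansion_shift_seq _ _
    (expansion_minus _ _ _ _ (expansion_mul_radicand x _ _ Ed)
      (expansion_minus _ _ _ _ (expansion_scal x _ _ Ep) (expansion_shift_seq _ _ Ep))))) as El.
  pose proof (expansion_plus _ _ _ _
    (expansion_minus _ _ _ _ (expansion_scal (alpha + beta) _ _ Eqp)
      (expansion_scal (alpha + beta) _ _ (expansion_mul_radicand x _ _ Ep)))
    (expansion_scal (alpha - beta) _ _ (expansion_shift_seq _ _ Eqp))) as Er.
  (* The left side carries a factor t, so the index m + 1 yields the coefficient m of the bracket,
     whose top term is (m + 1) p_(m+1). *)
  assert (H := expansion_unique _ _ _ _ (S m) El Er); simpl in H.
  rewrite shift_seq_derive_seq, shift_seq2_derive_seq in H.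
  transitivity (2 * (derive_seq p m - 2 * x * (INR m * p m) + (INR m - 1) * shift_seq p m
                     - (x * p m - shift_seq p m))
                + (2 * x * (2 * INR m + 1) * p m - 2 * INR m * shift_seq p m)).
  { unfold derive_seq; ring. }
  rewrite H; [ring |].
  apply filter_imp with (2 := regular_point_locally x); intros t Ht.
  pose proof (Jacobi_genfun_ode alpha beta x t Ht) as O; simpl in O.
  rewrite (Jacobi_R_sqr x t (proj1 Ht)) in O.
  etransitivity; [| etransitivity; [exact O |]]; ring.
Qed.

(** * The Laguerre generating function *)

(** Again the function times its logarithmic derivative; t/(1 - t) has derivative 1/(1 - t)^2. *)
Definition Laguerre_genfun_deriv (alpha x : C) (t : R) : C :=
  Laguerre_genfun alpha x t * ((alpha + 1) / (1 - t) - x / ((1 - t) * (1 - t))).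

Lemma is_Cderive_Laguerre_genfun (alpha x : C) (t : R) : (t < 1)%R ->
  is_Cderive (fun u => Laguerre_genfun alpha x u) t (Laguerre_genfun_deriv alpha x t).
Proof.
  intros Ht.
  assert (H : (0 < Re (1 - RtoC t))%R) by (simpl; lra).
  pose proof (Re_pos_neq_0 _ H) as Hne.
  pose proof (is_Cderive_minus _ _ _ _ _ (is_Cderive_const 1 t) (is_Cderive_RtoC t)) as D1.
  eapply is_Cderive_eq.
  - unfold Laguerre_genfun, Cdiv; apply is_Cderive_mult.
    + apply (is_Cderive_Cpower _ _ _ _ D1 H).
    + apply is_Cderive_Cexp, is_Cderive_mult; [| apply (is_Cderive_inv _ _ _ D1 H)].
      apply is_Cderive_opp, is_Cderive_mult; [apply is_Cderive_RtoC | apply is_Cderive_const].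
  - unfold Laguerre_genfun_deriv, Laguerre_genfun, Cdiv; cbv beta; field; exact Hne.
Qed.

Lemma Laguerre_expansion (L : nat -> C -> C -> C) (hL : is_Laguerre L) (alpha x : C) :
  expansion (fun n => L n alpha x) (fun t => Laguerre_genfun alpha x t).
Proof.
  exact (is_pseries_expansion _ (Laguerre_genfun alpha x) (mkposreal 1 Rlt_0_1) (hL alpha x)).
Qed.

Lemma Laguerre_0 (L : nat -> C -> C -> C) (hL : is_Laguerre L) (alpha x : C) :
  L 0%nat alpha x = 1.
Proof.
  rewrite (expansion_at_0 _ _ (Laguerre_expansion L hL alpha x)).
  unfold Laguerre_genfun.
  replace (1 - RtoC 0) with (RtoC 1) by ring; rewrite Cpower_1_l.
  replace (- (0 * x) / 1) with (RtoC 0) by field; rewrite Cexp_0; ring.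
Qed.

(** The three-term recurrence, read off from (1 - t)^2 G' = ((alpha + 1)(1 - t) - x) G. *)
Lemma Laguerre_recurrence (L : nat -> C -> C -> C) (hL : is_Laguerre L) (alpha x : C) (m : nat) :
  let l := fun n => L n alpha x in
  INR (S m) * l (S m) = (2 * INR m + alpha + 1 - x) * l m - (INR m + alpha) * shift_seq l m.
Proof.
  intros l.
  pose proof (Laguerre_expansion L hL alpha x) as El; fold l in El.
  assert (Hloc : locally 0%R (fun t => t < 1)%R) by apply (open_lt 1 0 Rlt_0_1).
  assert (Ed : expansion (derive_seq l) (Laguerre_genfun_deriv alpha x)).
  { apply (expansion_derive _ _ _ El).
    apply filter_imp with (2 := Hloc); intros t; apply is_Cderive_Laguerre_genfun. }
  (* At x = 1 the radicand is (1 - t)^2. *)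
  pose proof (expansion_mul_radicand 1 _ _ Ed) as E1.
  pose proof (expansion_minus _ _ _ _ (expansion_scal (alpha + 1 - x) _ _ El)
    (expansion_scal (alpha + 1) _ _ (expansion_shift_seq _ _ El))) as E2.
  assert (H := expansion_unique _ _ _ _ m E1 E2); cbv beta in H.
  rewrite shift_seq_derive_seq, shift_seq2_derive_seq in H.
  transitivity (derive_seq l m - 2 * 1 * (INR m * l m) + (INR m - 1) * shift_seq l m
                + (2 * INR m * l m - (INR m - 1) * shift_seq l m)).
  { unfold derive_seq; ring. }
  rewrite H; [ring |].
  apply filter_imp with (2 := Hloc); intros t Ht.
  unfold Laguerre_genfun_deriv; field.
  apply Re_pos_neq_0; simpl; lra.
Qed.

(** * Growth along the recurrences *)

(** One constant serves all of T. With the admissible parameters packed into T, this is a uniform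
    estimate without any limit. *)
Definition bigO {T : Type} (g : T -> R) (k : nat) (f : T -> C) : Prop :=
  exists M : R, forall t, (Cmod (f t) <= M * g t ^ k)%R.

Lemma bigO_ext {T : Type} (g : T -> R) (k : nat) (f f' : T -> C) :
  (forall t, f t = f' t) -> bigO g k f -> bigO g k f'.
Proof. intros E [M H]; exists M; intros t; rewrite <- E; apply H. Qed.

Lemma bigO_const {T : Type} (g : T -> R) (c : C) : bigO g 0 (fun _ => c).
Proof. exists (Cmod c); intros t; simpl; lra. Qed.

Lemma bigO_plus {T : Type} (g : T -> R) (k : nat) (f f' : T -> C) :
  bigO g k f -> bigO g k f' -> bigO g k (fun t => f t + f' t).
Proof.
  intros [M H] [M' H']; exists (M + M')%R; intros t.
  eapply Rle_trans; [apply Cmod_triangle |].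
  specialize (H t); specialize (H' t); lra.
Qed.

Lemma bigO_mult {T : Type} (g : T -> R) (k k' : nat) (f f' : T -> C) :
  bigO g k f -> bigO g k' f' -> bigO g (k + k') (fun t => f t * f' t).
Proof.
  intros [M H] [M' H']; exists (M * M')%R; intros t.
  rewrite Cmod_mult, pow_add.
  replace (M * M' * (g t ^ k * g t ^ k'))%R with ((M * g t ^ k) * (M' * g t ^ k'))%R by ring.
  apply Rmult_le_compat; auto using Cmod_ge_0.
Qed.

Lemma bigO_scal {T : Type} (g : T -> R) (k : nat) (c : C) (f : T -> C) :
  bigO g k f -> bigO g k (fun t => c * f t).
Proof. apply (bigO_mult g 0 k (fun _ => c)), bigO_const. Qed.

Lemma bigO_minus {T : Type} (g : T -> R) (k : nat) (f f' : T -> C) :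
  bigO g k f -> bigO g k f' -> bigO g k (fun t => f t - f' t).
Proof.
  intros H H'; apply (bigO_ext g k (fun t => f t + - (1) * f' t)); [intros t; ring |].
  apply bigO_plus; [exact H | apply bigO_scal, H'].
Qed.

Lemma bigO_weaken {T : Type} (g : T -> R) (k k' : nat) (f : T -> C) :
  (forall t, 1 <= g t)%R -> (k <= k')%nat -> bigO g k f -> bigO g k' f.
Proof.
  intros Hg Hk [M H]; exists M; intros t.
  pose proof (pow_lt (g t) k ltac:(pose proof (Hg t); lra)) as Hp.
  pose proof (Rle_pow (g t) k k' (Hg t) Hk) as Hle.
  pose proof (Cmod_ge_0 (f t)); specialize (H t).
  (* A modulus is nonnegative and g is positive, which forces the sign of M before the power is
     enlarged. *)
  assert (0 <= M)%R by (apply Rnot_lt_le; intros HM; nra).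
  nra.
Qed.

(** The prefactor c is estimated together with each summand, so an empty sum causes no trouble
    whatever the size of c. *)
Lemma bigO_scal_sum {T : Type} (g : T -> R) (k : nat) (c : T -> C) (f : nat -> T -> C) (i j : nat) :
  (forall s, (i <= s <= j)%nat -> bigO g k (fun t => c t * f s t)) ->
  (forall t, 1 <= g t)%R ->
  bigO g k (fun t => c t * sum_n_m (fun s => f s t) i j).
Proof.
  intros H Hg; induction j as [|j IH].
  - destruct i as [|i].
    + apply (bigO_ext g k (fun t => c t * f 0%nat t)); [| apply H; lia].
      intros t; rewrite sum_n_n; reflexivity.
    + apply (bigO_ext g k (fun _ => 0)); [| apply (bigO_weaken g 0); [exact Hg | lia | apply bigO_const]].
      intros t; rewrite sum_n_m_zero by lia; symmetry; apply Cmult_0_r.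
  - destruct (Nat.le_gt_cases i (S j)) as [Hi | Hi].
    + apply (bigO_ext g k (fun t => c t * sum_n_m (fun s => f s t) i j + c t * f (S j) t)).
      { intros t; rewrite sum_n_Sm by exact Hi; symmetry; apply Cmult_plus_distr_l. }
      apply bigO_plus; [apply IH; intros s Hs |]; apply H; lia.
    + apply (bigO_ext g k (fun _ => 0)); [| apply (bigO_weaken g 0); [exact Hg | lia | apply bigO_const]].
      intros t; rewrite sum_n_m_zero by lia; symmetry; apply Cmult_0_r.
Qed.

(** Encodes (m + 1) p_(m+1) = h p_m + O(g^m). The remainder may use the growth of all earlier terms,
    which strong induction supplies. *)
Definition leading_recurrence {T : Type} (g : T -> R) (h : T -> C) (p : nat -> T -> C) : Prop :=
  (forall t, p 0%nat t = 1) /\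
  forall m, (forall j, (j <= m)%nat -> bigO g j (p j)) ->
    bigO g m (fun t => INR (S m) * p (S m) t - h t * p m t).

Lemma INR_S_neq_0 (m : nat) : RtoC (INR (S m)) <> 0.
Proof. intros E; apply (not_0_INR (S m)); [lia | apply RtoC_inj, E]. Qed.

Lemma leading_recurrence_bigO {T : Type} (g : T -> R) (h : T -> C) (p : nat -> T -> C) :
  (forall t, 1 <= g t)%R -> bigO g 1 h -> leading_recurrence g h p ->
  forall n, bigO g n (p n).
Proof.
  intros Hg Hh [H0 HS].
  assert (Hall : forall n j, (j <= n)%nat -> bigO g j (p j)).
  { induction n as [|n IH]; intros j Hj.
    - replace j with 0%nat by lia.
      apply (bigO_ext g 0 (fun _ => 1)); [intros t; symmetry; apply H0 | apply bigO_const].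
    - destruct (Nat.eq_dec j (S n)) as [-> |]; [| apply IH; lia].
      apply (bigO_ext g (S n) (fun t => / INR (S n) *
        ((INR (S n) * p (S n) t - h t * p n t) + h t * p n t))).
      { intros t; field; apply INR_S_neq_0. }
      apply bigO_scal, bigO_plus.
      + apply (bigO_weaken g n); [exact Hg | lia |]; apply HS, IH.
      + apply (bigO_mult g 1 n); [exact Hh | apply IH; lia]. }
  intros n; apply (Hall n n); lia.
Qed.

(** Subtracting the recurrences cancels the starting values and leaves (n + 1) d_(n+1) = h d_n +
    O(g^n). The factor c, later gamma, gains one order and avoids a negative exponent at n = 0. *)
Lemma leading_recurrence_diff {T : Type} (g : T -> R) (h c : T -> C) (p l : nat -> T -> C) :
  (forall t, 1 <= g t)%R -> bigO g 1 h -> bigO g 1 c ->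
  leading_recurrence g h p -> leading_recurrence g h l ->
  forall n, bigO g n (fun t => c t * (p n t - l n t)).
Proof.
  intros Hg Hh Hc Hp Hl n.
  pose proof (leading_recurrence_bigO g h p Hg Hh Hp) as Op.
  pose proof (leading_recurrence_bigO g h l Hg Hh Hl) as Ol.
  destruct Hp as [p0 pS], Hl as [l0 lS].
  induction n as [|n IH].
  - apply (bigO_ext g 0 (fun _ => 0)); [| apply bigO_const].
    intros t; rewrite p0, l0; ring.
  - apply (bigO_ext g (S n) (fun t => / INR (S n) *
      (h t * (c t * (p n t - l n t)) + c t * ((INR (S n) * p (S n) t - h t * p n t)
         - (INR (S n) * l (S n) t - h t * l n t))))).
    { intros t; field; apply INR_S_neq_0. }
    apply bigO_scal, bigO_plus.
    + apply (bigO_mult g 1 n); [exact Hh | exact IH].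
    + apply (bigO_mult g 1 n); [exact Hc |].
      apply bigO_minus; [apply pS; intros; apply Op | apply lS; intros; apply Ol].
Qed.

(** * The family of admissible parameters and the two recurrences on it *)

(** Triples bundled with their bounds, so that [bigO] over this type is uniform under the hypotheses
    of the theorem with threshold 1. *)
Record params (K X : R) : Type := Params {
  par_alpha : C; par_beta : C; par_x : C;
  par_alpha_le : (Cmod par_alpha <= K * Cmod (par_alpha + par_beta))%R;
  par_x_le : (Cmod par_x <= X)%R;
  par_gamma_ge : (1 <= Cmod (par_alpha + par_beta))%R }.

Arguments par_alpha {K X}. Arguments par_beta {K X}. Arguments par_x {K X}.

Definition par_gamma {K X : R} (t : params K X) : C := par_alpha t + par_beta t.
Definition par_scale {K X : R} (t : params K X) : R := Cmod (par_gamma t).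
Definition par_xi {K X : R} (t : params K X) : C :=
  / 2 * (par_alpha t + par_beta t + 2) * (1 - par_x t).
(* The common value of P_1 and L_1. *)
Definition par_head {K X : R} (t : params K X) : C := par_alpha t + 1 - par_xi t.

Lemma par_scale_ge_1 {K X : R} (t : params K X) : (1 <= par_scale t)%R.
Proof. destruct t; assumption. Qed.

Lemma bigO_alpha (K X : R) : bigO par_scale 1 (@par_alpha K X).
Proof. exists K; intros [a b x Ha Hx Hg]; unfold par_scale, par_gamma; simpl; rewrite Rmult_1_r; exact Ha. Qed.

Lemma bigO_gamma (K X : R) : bigO par_scale 1 (@par_gamma K X).
Proof. exists 1%R; intros t; unfold par_scale; lra. Qed.

Lemma bigO_x (K X : R) : bigO par_scale 0 (@par_x K X).
Proof. exists X; intros [a b x Ha Hx Hg]; simpl; lra. Qed.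

Lemma bigO_head (K X : R) : bigO par_scale 1 (@par_head K X).
Proof.
  (* Expanding xi = (gamma + 2)(1 - x)/2 cancels the constant 1. *)
  apply (bigO_ext _ _ (fun t => par_alpha t - / 2 * par_gamma t + / 2 * (par_x t * par_gamma t) + par_x t)).
  { intros t; unfold par_head, par_xi, par_gamma; field. }
  pose proof (bigO_gamma K X) as Hg; pose proof (bigO_x K X) as Hx.
  apply bigO_plus; [apply bigO_plus; [apply bigO_minus |] |].
  - apply bigO_alpha.
  - apply bigO_scal, Hg.
  - apply bigO_scal, (bigO_mult _ 0 1); assumption.
  - apply (bigO_weaken _ 0); [apply par_scale_ge_1 | lia | exact Hx].
Qed.

(** The remainder is 2m l_m - (m + alpha) l_(m-1); the factor alpha = O(gamma) meets a term of order
    m - 1. *)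
Lemma Laguerre_leading_recurrence (L : nat -> C -> C -> C) (hL : is_Laguerre L) (K X : R) :
  leading_recurrence par_scale (@par_head K X) (fun n t => L n (par_alpha t) (par_xi t)).
Proof.
  split; [intros t; apply (Laguerre_0 L hL) |].
  intros m Hm.
  apply (bigO_ext _ _ (fun t => 2 * INR m * L m (par_alpha t) (par_xi t)
    - (INR m + par_alpha t) * shift_seq (fun n => L n (par_alpha t) (par_xi t)) m)).
  { intros t; rewrite (Laguerre_recurrence L hL); unfold par_head; ring. }
  apply bigO_minus; [apply bigO_scal, Hm; lia |].
  destruct m as [|m].
  - apply (bigO_ext _ _ (fun _ => 0)); [intros t; simpl; ring | apply bigO_const].
  - apply (bigO_mult _ 1 m); [| apply Hm; lia].
    apply bigO_plus; [| apply bigO_alpha].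
    apply (bigO_weaken _ 0); [apply par_scale_ge_1 | lia | apply bigO_const].
Qed.

Lemma sum_n_m_first (f : nat -> C) (n m : nat) : (n <= m)%nat ->
  sum_n_m f n m = f n + sum_n_m f (S n) m.
Proof. intros H; rewrite (sum_Sn_m f n m H); reflexivity. Qed.

(** Splits off the Cauchy terms with q_0 = 1 and q_1 = -x. Then gamma p_(m+1) cancels, and the terms
    in p_m combine to the head plus 2mx. Writing alpha - beta as 2 alpha - gamma leaves only
    quantities with known bounds. *)
Lemma Jacobi_recurrence (P : nat -> C -> C -> C -> C) (hP : is_Jacobi P) (alpha beta x : C) (m : nat) :
  let p := fun n => P n alpha beta x in
  let q := Jacobi_R_coef P x in
  INR (S m) * p (S m) =
  (alpha + 1 - / 2 * (alpha + beta + 2) * (1 - x)) * p m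
  + 2 * INR m * (x * p m) - INR m * shift_seq p m - / 2 * ((alpha + beta) * shift_seq p m)
  + / 2 * ((alpha + beta) * sum_n_m (fun k => q k * p (S m - k)%nat) 2 (S m))
  + / 2 * ((2 * alpha - (alpha + beta)) * sum_n_m (fun k => q k * p (m - k)%nat) 1 m).
Proof.
  intros p q.
  (* At alpha = beta = 0 the Cauchy products have coefficient 0, so this reads 2 P_1 = 2x P_0 and
     determines q_1. *)
  pose proof (Jacobi_recurrence_Cauchy P hP 0 0 x 0) as R0; cbv zeta in R0.
  assert (l0 : P 0%nat 0 0 x = 1) by apply (Jacobi_0 P hP).
  assert (l1 : P 1%nat 0 0 x = x).
  { transitivity (/ 2 * (2 * (INR 1 * P 1%nat 0 0 x))); [simpl; field |].
    rewrite R0, l0; simpl; field. }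
  assert (q0 : q 0%nat = 1) by (unfold q, Jacobi_R_coef; simpl; rewrite l0; ring).
  assert (q1 : q 1%nat = - x) by (unfold q, Jacobi_R_coef; simpl; rewrite l0, l1; ring).
  pose proof (Jacobi_recurrence_Cauchy P hP alpha beta x m) as Rm; cbv zeta in Rm.
  fold p q in Rm; unfold Cauchy_prod in Rm.
  rewrite (sum_n_m_first _ 0 (S m)), (sum_n_m_first _ 1 (S m)), (sum_n_m_first _ 0 m) in Rm by lia.
  rewrite q0, q1, !Nat.sub_0_r in Rm.
  replace (S m - 1)%nat with m in Rm by lia.
  change (P (S m) alpha beta x) with (p (S m)) in Rm; change (P m alpha beta x) with (p m) in Rm.
  transitivity (/ 2 * (2 * (INR (S m) * p (S m)))); [field |].
  rewrite Rm; field.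
Qed.

(** For alpha = beta = 0 the recurrence becomes that of the Legendre polynomials, whose coefficients
    are bounded for bounded x. *)
Lemma bigO_Legendre (P : nat -> C -> C -> C -> C) (hP : is_Jacobi P) (K X : R) (n : nat) :
  bigO (@par_scale K X) 0 (fun t => P n 0 0 (par_x t)).
Proof.
  assert (Hall : forall n j, (j <= n)%nat -> bigO (@par_scale K X) 0 (fun t => P j 0 0 (par_x t))).
  { clear n; induction n as [|n IH]; intros j Hj.
    - replace j with 0%nat by lia.
      apply (bigO_ext _ 0 (fun _ => 1)); [intros t; symmetry; apply (Jacobi_0 P hP) | apply bigO_const].
    - destruct (Nat.eq_dec j (S n)) as [-> |]; [| apply IH; lia].
      apply (bigO_ext _ 0 (fun t => / INR (S n) * ((2 * INR n + 1) * (par_x t * P n 0 0 (par_x t))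
        - INR n * shift_seq (fun k => P k 0 0 (par_x t)) n))).
      { intros t; pose proof (Jacobi_recurrence P hP 0 0 (par_x t) n) as R; cbv zeta in R.
        transitivity (/ INR (S n) * (INR (S n) * P (S n) 0 0 (par_x t)));
          [rewrite R; field | field]; apply INR_S_neq_0. }
      apply bigO_scal, bigO_minus; apply bigO_scal.
      + apply (bigO_mult _ 0 0); [apply bigO_x | apply IH; lia].
      + destruct n as [|n]; [exact (bigO_const _ 0) | apply IH; lia]. }
  apply (Hall n n); lia.
Qed.

Lemma bigO_Jacobi_R_coef (P : nat -> C -> C -> C -> C) (hP : is_Jacobi P) (K X : R) (n : nat) :
  bigO (@par_scale K X) 0 (fun t => Jacobi_R_coef P (par_x t) n).
Proof.
  unfold Jacobi_R_coef.
  apply bigO_plus; [apply bigO_minus; [apply (bigO_Legendre P hP) |] |].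
  - apply (bigO_mult _ 0 0).
    + apply bigO_scal, bigO_x.
    + destruct n as [|n]; [exact (bigO_const _ 0) | apply (bigO_Legendre P hP)].
  - destruct n as [|[|n]]; [exact (bigO_const _ 0) | exact (bigO_const _ 0) | apply (bigO_Legendre P hP)].
Qed.

Lemma Jacobi_leading_recurrence (P : nat -> C -> C -> C -> C) (hP : is_Jacobi P) (K X : R) :
  leading_recurrence par_scale (@par_head K X) (fun n t => P n (par_alpha t) (par_beta t) (par_x t)).
Proof.
  split; [intros t; apply (Jacobi_0 P hP) |].
  intros m Hm.
  set (p := fun n (t : params K X) => P n (par_alpha t) (par_beta t) (par_x t)) in *.
  set (q := fun n (t : params K X) => Jacobi_R_coef P (par_x t) n).
  apply (bigO_ext _ _ (fun t => 2 * INR m * (par_x t * p m t)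
    - INR m * shift_seq (fun n => p n t) m - / 2 * (par_gamma t * shift_seq (fun n => p n t) m)
    + / 2 * (par_gamma t * sum_n_m (fun k => q k t * p (S m - k)%nat t) 2 (S m))
    + / 2 * ((2 * par_alpha t - par_gamma t) * sum_n_m (fun k => q k t * p (m - k)%nat t) 1 m))).
  { intros t; unfold p, q; cbv beta; rewrite (Jacobi_recurrence P hP); cbv zeta beta.
    unfold par_head, par_xi, par_gamma; ring. }
  pose proof (@par_scale_ge_1 K X) as Hg.
  pose proof (bigO_gamma K X) as Og.
  (* A factor of order 1, a bounded q_k and p_s with s < m give order 1 + s, at most m. *)
  assert (Hsum : forall (c : params K X -> C) s, bigO par_scale 1 c -> (s < m)%nat -> forall k,
    bigO par_scale m (fun t => c t * (q k t * p s t))).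
  { intros c s Hc Hs k; apply (bigO_weaken _ (1 + (0 + s))); [exact Hg | lia |].
    apply bigO_mult; [exact Hc |].
    apply bigO_mult; [apply (bigO_Jacobi_R_coef P hP) | apply Hm; lia]. }
  apply bigO_plus; [apply bigO_plus; [apply bigO_minus; [apply bigO_minus |] |] |].
  - apply bigO_scal, (bigO_mult _ 0 m); [apply bigO_x | apply Hm; lia].
  - apply bigO_scal; destruct m as [|m]; [exact (bigO_const _ 0) |].
    apply (bigO_weaken _ m); [exact Hg | lia | apply Hm; lia].
  - apply bigO_scal; destruct m as [|m].
    + apply (bigO_ext _ _ (fun _ => 0)); [intros t; simpl; ring | apply bigO_const].
    + apply (bigO_mult _ 1 m); [exact Og | apply Hm; lia].
  - apply bigO_scal, (bigO_scal_sum par_scale m par_gamma (fun k t => q k t * p (S m - k)%nat t));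
      [| exact Hg].
    (* The sum starts at k = 2, so m + 1 - k < m. *)
    intros k Hk; apply Hsum; [exact Og | lia].
  - apply bigO_scal, (bigO_scal_sum par_scale m (fun t => 2 * par_alpha t - par_gamma t)
      (fun k t => q k t * p (m - k)%nat t)); [| exact Hg].
    (* Here k starts at 1, so m - k < m. *)
    intros k Hk; apply Hsum; [| lia].
    apply bigO_minus; [apply bigO_scal, bigO_alpha | exact Og].
Qed.

(* The O-term is for n fixed and alpha + beta -> infinity, uniformly for
   alpha = O(alpha + beta) and bounded x. *)
Theorem mainTheorem3
  (P : nat -> C -> C -> C -> C) (hP : is_Jacobi P)
  (L : nat -> C -> C -> C) (hL : is_Laguerre L)
  (n : nat) (K X : R) :
  exists M G : R, forall alpha beta x : C,
    let c := alpha in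
    let gamma := alpha + beta in
    let xi := / 2 * (alpha + beta + 2) * (1 - x) in
    (Cmod alpha <= K * Cmod gamma)%R ->
    (Cmod x <= X)%R ->
    (G <= Cmod gamma)%R ->
    (Cmod (P n alpha beta x - L n c xi)
       <= M * powerRZ (Cmod gamma) (Z.of_nat n - 1))%R.
Proof.
  (* With c = gamma this bounds gamma (P_n - L_n) by M |gamma|^n. *)
  destruct (leading_recurrence_diff par_scale par_head par_gamma _ _
    (@par_scale_ge_1 K X) (bigO_head K X) (bigO_gamma K X)
    (Jacobi_leading_recurrence P hP K X) (Laguerre_leading_recurrence L hL K X) n) as [M HM].
  exists M, 1%R; intros alpha beta x c gamma xi Ha Hx Hg.
  specialize (HM (Params K X alpha beta x Ha Hx Hg)).
  unfold par_scale, par_xi, par_gamma in HM; simpl in HM; fold gamma in HM.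
  rewrite Cmod_mult in HM.
  assert (Hpos : (0 < Cmod gamma)%R) by lra.
  (* The exponent is -1 for n = 0, so the power is split as |gamma|^n |gamma|^(-1) and the inverse
     is cleared by multiplication. *)
  replace (Z.of_nat n - 1)%Z with (Z.of_nat n + (- 1))%Z by lia.
  rewrite powerRZ_add, <- pow_powerRZ by lra.
  apply (Rmult_le_reg_l (Cmod gamma)); [exact Hpos |].
  eapply Rle_trans; [exact HM |].
  right; simpl; field; lra.
Qed.
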